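(* For every $n\in\mathbb{Z}$ let $G_n$ be a finitely generated group, $z_n$ a non-trivial central element of $G_n$, $\langle z_n\rangle$ the subgroup of $G_n$ generated by $z_n$, and $P_n$ the positive cone of an isolated left ordering $<_n$ of $G_n$. Let $\varphi_n:\langle z_n\rangle\to\langle z_{n+1}\rangle$ be the isomorphism with $\varphi_n(z_n)=z_{n+1}$. Suppose that: (i) for every $n$, $P_n$ is generated by elements $g_{1,n},\dots,g_{j_n,n}$ of $G_n$ as a semigroup; (ii) for every $n$, $g_{i,n}<_n z_n$ holds for every integer $i\in\{1,\dots,j_n\}$; (iii) $\langle z_n\rangle$ is not isomorphic to $G_n$ for infinitely many $n$. Let $G_{(\infty)}=\varinjlim G_{(m)}$ be the inductive limit of the inductive system of amalgamated free products $G_{(m)}$ of the systems $\{G_n,\langle z_n\rangle,\varphi_n\}_{-m\le n\le m}$, and let $P_{(\infty)}\subset G_{(\infty)}$ be the subset induced by the $P_n$'s (constructed in the context). Then $P_{(\infty)}$ is the positive cone of a left ordering of $G_{(\infty)}$, and this left ordering is approximated by its conjugate orderings. In particular, $P_{(\infty)}$ is not the positive cone of an isolated ordering of $G_{(\infty)}$.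
   Context: A left ordering of a group $G$ is a total order $<_G$ on $G$ with $a<_G b\Rightarrow ga<_G gb$. Its positive cone is $P=\{g\in G:1<_G g\}$. A subset $P\subset G$ is the positive cone of a left ordering iff $P\cdot P\subset P$ and $G=P\sqcup P^{-1}\sqcup\{1\}$; left orderings are identified with their positive cones via $g<_G h\iff g^{-1}h\in P$. $\langle S\rangle^{+}$ is the subsemigroup generated by $S$. $\mathrm{LO}(G)$ is the set of left orderings of $G$ with the topology having sub-basis the sets $\{<'\in\mathrm{LO}(G):1<'g\}$, $g\in G$. An isolated ordering is an isolated point of $\mathrm{LO}(G)$. For $g\in G$ the conjugate ordering $<_g$ of $<_G$ is $g_1<_g g_2\iff g_1g<_G g_2g$. A left ordering is approximated by its conjugate orderings if every neighbourhood of it in $\mathrm{LO}(G)$ contains a conjugate ordering of it different from it. Construction of $G_{(\infty)}$. Put $G_{(0)}=G_0$. Given $G_{(m)}$ (containing $G_m$ and $G_{-m}$), let $G'_{(m)}=G_{(m)}*_{\langle z_m\rangle}G_{m+1}$ be the amalgamated free product identifying $z_m\in G_m\subset G_{(m)}$ with $\varphi_m(z_m)=z_{m+1}$, and let $G_{(m+1)}=G_{-m-1}*_{\langle z_{-m-1}\rangle}G'_{(m)}$ be the amalgamated free product identifying $z_{-m-1}$ with $\varphi_{-m-1}(z_{-m-1})=z_{-m}\in G_{-m}\subset G'_{(m)}$. All factors are subgroups of these products, $G_{(m)}\subset G'_{(m)}\subset G_{(m+1)}$, and $G_{(\infty)}=\bigcup_m G_{(m)}$. In $G_{(m)}$ all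 $z_n$, $|n|\le m$, coincide. Construction of $P_{(\infty)}$. Ito's amalgamation: let $G$ and $H$ be groups with positive cones $\langle g_1,\dots,g_s\rangle^{+}$ and $\langle h_1,\dots,h_t\rangle^{+}$, numbered so that $1<_G g_1<_G\dots<_G g_s$ and $1<_H h_1<_H\dots<_H h_t$, and let $z_G\in G$ and $z_H\in H$ be non-trivial with $z_G$ central in $G$, $g_i<_G z_G$ and $h_i<_H z_H$ for all $i$, and $<_H$ invariant under right multiplication by $z_H$. By a theorem of Ito, in $X=G*_{\langle z_G=z_H\rangle}H$ the subsemigroup $\langle x_1,\dots,x_s,h_1,\dots,h_t\rangle^{+}$ with $x_i=g_iz_H^{-1}h_1$ is the positive cone of an isolated left ordering of $X$; it depends only on $<_G,<_H,z_G,z_H$, it extends the orderings of $G$ and $H$, and its listed generators are smaller than $z_G=z_H$. Put $P_{(0)}=P_0$. Given $P_{(m)}$, let $P'_{(m)}$ be the positive cone of $G'_{(m)}$ obtained by this amalgamation with $G=G_{(m)}$ (cone $P_{(m)}$), $H=G_{m+1}$ (cone $P_{m+1}$), $z_G=z_0$, $z_H=z_{m+1}$; then let $P_{(m+1)}$ be the positive cone of $G_{(m+1)}$ obtained by this amalgamation with $G=G_{-m-1}$ (cone $P_{-m-1}$), $H=G'_{(m)}$ (cone $P'_{(m)}$), $z_G=z_{-m-1}$, $z_H=z_0$. Then $P_{(m)}\subset P_{(m+1)}$, and $P_{(\infty)}=\varinjlim P_{(m)}=\bigcup_m P_{(m)}$. *)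

(* Defs.v *)
From HB Require Import structures.
From mathcomp Require Import all_boot all_order all_algebra.
From mathcomp Require Import all_classical all_reals topology.

Set Implicit Arguments.
Unset Strict Implicit.
Unset Printing Implicit Defensive.

Local Open Scope classical_set_scope.
Local Open Scope group_scope.

Definition mul_closed (G : groupType) (S : set G) : Prop :=
  forall x y, S x -> S y -> S (x * y).

Definition subgroup_closed (G : groupType) (S : set G) : Prop :=
  [/\ S 1, mul_closed S & forall x, S x -> S x^-1].

Definition semigroup_gen (G : groupType) (S : set G) : set G :=
  smallest (@mul_closed G) S.

Definition subgroup_gen (G : groupType) (S : set G) : set G :=
  smallest (@subgroup_closed G) S.

Definition finitely_generated (G : groupType) : Prop :=
  exists s : seq G, subgroup_gen [set` s] = setT.

(* An isomorphism between K and the subgroup A of G, seen as an injective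
   homomorphism from K to G with image A. *)
Definition isomorphic_to_subgroup (K G : groupType) (A : set G) : Prop :=
  exists f : {multiplicative K -> G}, injective f /\ range f = A.

Record leftOrder (G : groupType) := LeftOrder {
  lo_lt :> G -> G -> Prop;
  lo_irr : forall a, ~ lo_lt a a;
  lo_trans : forall a b c, lo_lt a b -> lo_lt b c -> lo_lt a c;
  lo_total : forall a b, [\/ lo_lt a b, a = b | lo_lt b a];
  lo_left : forall g a b, lo_lt a b -> lo_lt (g * a) (g * b) }.

Definition pos_cone (G : groupType) (o : leftOrder G) : set G :=
  [set g | o 1 g].

HB.instance Definition _ (G : groupType) := gen_eqMixin (leftOrder G).
HB.instance Definition _ (G : groupType) := gen_choiceMixin (leftOrder G).

Definition lo_subbase (G : groupType) : set (set (leftOrder G)) :=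
  range (fun g : G => [set o : leftOrder G | o 1 g]).

HB.instance Definition _ (G : groupType) :=
  isSubBaseTopological.Build (leftOrder G) (@lo_subbase G) id.

Section Conjugate.
Variables (G : groupType) (o : leftOrder G) (g : G).

Let conj_lt (a b : G) : Prop := o (a * g) (b * g).

Fact conj_irr a : ~ conj_lt a a.
Proof. exact: lo_irr. Qed.

Fact conj_trans a b c : conj_lt a b -> conj_lt b c -> conj_lt a c.
Proof. exact: lo_trans. Qed.

Fact conj_total a b : [\/ conj_lt a b, a = b | conj_lt b a].
Proof.
have [ab|/mulIg ab|ba] := lo_total o (a * g) (b * g).
- exact: Or31.
- exact: Or32.
- exact: Or33.
Qed.

Fact conj_left h a b : conj_lt a b -> conj_lt (h * a) (h * b).
Proof. by rewrite /conj_lt -!mulgA; exact: lo_left. Qed.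

Definition conj_order : leftOrder G :=
  LeftOrder conj_irr conj_trans conj_total conj_left.

End Conjugate.

Definition approximated_by_conjugates (G : groupType) (o : leftOrder G) : Prop :=
  forall U : set (leftOrder G), nbhs o U ->
    exists g : G, U (conj_order o g) /\ conj_order o g <> o.

(* The colimit of a family of groups G i under identifications E of elements:
   words in the disjoint union of the G i, modulo the congruence generated by
   the multiplication of each G i and by E. *)
Section GroupColimit.
Variables (I : choiceType) (G : I -> groupType).

Definition letter : Type := {i : I & G i}.

HB.instance Definition _ := gen_eqMixin letter.
HB.instance Definition _ := gen_choiceMixin letter.

Definition mkletter (i : I) (x : G i) : letter := existT (fun i => G i : Type) i x.

Variable E : letter -> letter -> Prop.

Inductive word_eq : seq letter -> seq letter -> Prop :=
| word_refl u : word_eq u u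
| word_sym u v : word_eq u v -> word_eq v u
| word_trans u v w : word_eq u v -> word_eq v w -> word_eq u w
| word_cat u u' v v' : word_eq u u' -> word_eq v v' -> word_eq (u ++ v) (u' ++ v')
| word_mul i (x y : G i) :
    word_eq [:: mkletter x; mkletter y] [:: mkletter (x * y)]
| word_one i : word_eq [:: mkletter (1 : G i)] [::]
| word_ident a b : E a b -> word_eq [:: a] [:: b].

Definition word_eqb (u v : seq letter) : bool := `[< word_eq u v >].

Fact word_eqb_refl : reflexive word_eqb.
Proof. by move=> u; apply/asboolP; exact: word_refl. Qed.

Fact word_eqb_sym : symmetric word_eqb.
Proof. by move=> u v; apply/asboolP/asboolP; exact: word_sym. Qed.

Fact word_eqb_trans : transitive word_eqb.
Proof.
by move=> v u w /asboolP uv /asboolP vw; apply/asboolP; exact: word_trans uv vw.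
Qed.

Definition word_equiv : equiv_rel (seq letter) :=
  EquivRel word_eqb word_eqb_refl word_eqb_sym word_eqb_trans.

Definition gcolim : Type := {eq_quot word_equiv}%qT.
HB.instance Definition _ := Choice.on gcolim.

Definition word_class (u : seq letter) : gcolim := (\pi_({eq_quot word_equiv}) u)%qT.

Definition word_repr (x : gcolim) : seq letter :=
  repr (x : {eq_quot word_equiv}%qT).

Lemma word_reprK x : word_class (word_repr x) = x.
Proof. exact: reprK. Qed.

Lemma word_classP u v : word_class u = word_class v <-> word_eq u v.
Proof.
rewrite /word_class; split.
  by move/eqquotP => /asboolP.
by move=> uv; apply/eqquotP/asboolP.
Qed.

Definition letter_inv (a : letter) : letter := mkletter (tagged a)^-1.

Definition word_inv (u : seq letter) : seq letter := rev (map letter_inv u).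

Lemma word_cons_inv a : word_eq [:: a; letter_inv a] [::].
Proof.
case: a => i x; apply: word_trans (word_mul _ _) _.
by rewrite mulgV; exact: word_one.
Qed.

Lemma letter_invK : involutive letter_inv.
Proof. by case=> i x; rewrite /letter_inv /= invgK. Qed.

Lemma word_invK : involutive word_inv.
Proof.
by move=> u; rewrite /word_inv map_rev revK -map_comp map_id_in// => a _;
  exact: letter_invK.
Qed.

Lemma word_mulV u : word_eq (u ++ word_inv u) [::].
Proof.
elim/last_ind: u => [|u a IHu]; first exact: word_refl.
rewrite /word_inv map_rcons rev_rcons -/(word_inv u) -cats1 -catA /=.
apply: word_trans IHu; apply: word_cat; first exact: word_refl.
rewrite -[X in word_eq _ X]cat0s -[_ :: _ :: _]/([:: a; letter_inv a] ++ word_inv u).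
by apply: word_cat; [exact: word_cons_inv|exact: word_refl].
Qed.

Lemma word_Vmul u : word_eq (word_inv u ++ u) [::].
Proof. by rewrite -{2}[u]word_invK; exact: word_mulV. Qed.

Definition gcolim_mul (x y : gcolim) : gcolim :=
  word_class (word_repr x ++ word_repr y).
Definition gcolim_one : gcolim := word_class [::].
Definition gcolim_inv (x : gcolim) : gcolim := word_class (word_inv (word_repr x)).

Lemma word_class_cat u v :
  gcolim_mul (word_class u) (word_class v) = word_class (u ++ v).
Proof.
by apply/word_classP; apply: word_cat; apply/word_classP; rewrite word_reprK.
Qed.

Fact gcolim_mulA : associative gcolim_mul.
Proof.
move=> x y z; rewrite -[x]word_reprK -[y]word_reprK -[z]word_reprK.
by rewrite !word_class_cat catA.
Qed.

Fact gcolim_mul1 : left_id gcolim_one gcolim_mul.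
Proof. by move=> x; rewrite -[x]word_reprK word_class_cat. Qed.

Fact gcolim_1mul : right_id gcolim_one gcolim_mul.
Proof. by move=> x; rewrite -[x]word_reprK word_class_cat cats0. Qed.

Fact gcolim_Vmul : left_inverse gcolim_one gcolim_inv gcolim_mul.
Proof.
move=> x; rewrite /gcolim_inv -{2}[x]word_reprK word_class_cat.
by apply/word_classP; exact: word_Vmul.
Qed.

Fact gcolim_mulV : right_inverse gcolim_one gcolim_inv gcolim_mul.
Proof.
move=> x; rewrite /gcolim_inv -{1}[x]word_reprK word_class_cat.
by apply/word_classP; exact: word_mulV.
Qed.

HB.instance Definition _ := isGroup.Build gcolim
  gcolim_mulA gcolim_mul1 gcolim_1mul gcolim_Vmul gcolim_mulV.

Definition gcolim_in (i : I) (x : G i) : gcolim := word_class [:: mkletter x].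

Fact gcolim_in_mul i : {morph @gcolim_in i : x y / x * y}.
Proof.
move=> x y; rewrite [RHS]word_class_cat; apply/word_classP/word_sym.
exact: word_mul.
Qed.

HB.instance Definition _ i :=
  isMultiplicative.Build (G i) gcolim (@gcolim_in i) (@gcolim_in_mul i).

Lemma gcolim_in_ident a b : E a b -> gcolim_in (tagged a) = gcolim_in (tagged b).
Proof. by move=> ab; apply/word_classP; case: a b ab => i x [j y]; exact: word_ident. Qed.

Definition word_eval (H : groupType) (f : forall i, G i -> H) (u : seq letter) : H :=
  \prod_(a <- u) f (tag a) (tagged a).

Lemma word_eval_eq (H : groupType) (f : forall i, {multiplicative G i -> H}) u v :
  (forall a b, E a b -> f (tag a) (tagged a) = f (tag b) (tagged b)) ->
  word_eq u v -> word_eval f u = word_eval f v.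
Proof.
rewrite /word_eval => fE; elim=> {u v}.
- by [].
- by move=> u v _ ->.
- by move=> u v w _ -> _ ->.
- by move=> u u' v v' _ uu' _ vv'; rewrite !big_cat /= uu' vv'.
- by move=> i x y; rewrite !big_cons !big_nil !mulg1 /= gmulfM.
- move=> i; rewrite big_cons !big_nil mulg1 /=.
  by apply: (mulgI (f i 1)); rewrite -gmulfM !mulg1.
- by move=> a b ab; rewrite !big_cons !big_nil !mulg1; exact: fE.
Qed.

Lemma gcolim_univ (H : groupType) (f : forall i, {multiplicative G i -> H}) :
  (forall a b, E a b -> f (tag a) (tagged a) = f (tag b) (tagged b)) ->
  exists F : {multiplicative gcolim -> H},
    (forall i x, F (@gcolim_in i x) = f i x) /\
    (forall F' : {multiplicative gcolim -> H},
       (forall i x, F' (@gcolim_in i x) = f i x) -> F' =1 F).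
Proof.
move=> fE; pose F (x : gcolim) : H := word_eval f (word_repr x).
have FE u : F (word_class u) = word_eval f u.
  by apply: word_eval_eq => //; apply/word_classP; exact: word_reprK.
have FM : {morph F : x y / x * y}.
  move=> x y; rewrite -[x]word_reprK -[y]word_reprK [X in F X]word_class_cat.
  by rewrite !FE /word_eval big_cat.
pose F_mul := isMultiplicative.Build gcolim H F FM.
pose F_ : {multiplicative gcolim -> H} := HB.pack F F_mul.
exists F_; split=> [i x|F' F'E x] /=; first by rewrite FE /word_eval big_seq1.
rewrite -[x]word_reprK FE; elim: (word_repr x) => [|[i y] u IHu].
  rewrite /word_eval big_nil.
  by apply: (mulgI (F' 1)); rewrite -gmulfM !mulg1.
have -> : word_eval f (existT _ i y :: u) = f i y * word_eval f u.
  by rewrite /word_eval big_cons.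
rewrite -IHu -F'E -gmulfM; congr (F' _).
by rewrite [RHS]word_class_cat.
Qed.

End GroupColimit.

(* A group with a distinguished element, a set of semigroup generators and a
   positive cone. *)
Record coneData := ConeData {
  cd_group :> groupType;
  cd_z : cd_group;
  cd_gens : set cd_group;
  cd_cone : set cd_group }.
Arguments cd_gens : clear implicits.
Arguments cd_cone : clear implicits.

Section Amalgam.
Variables A B : coneData.

Definition amalgam_factor (b : bool) : groupType := if b then A else B.

Definition amalgam_letterl (x : A) : letter amalgam_factor :=
  mkletter (G := amalgam_factor) (i := true) x.
Definition amalgam_letterr (x : B) : letter amalgam_factor :=
  mkletter (G := amalgam_factor) (i := false) x.

Definition amalgam_ident (a b : letter amalgam_factor) : Prop :=
  a = amalgam_letterl (cd_z A) /\ b = amalgam_letterr (cd_z B).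

(* A *_{<z_A> = <z_B>} B; since z_A = z_B, all their powers are identified. *)
Definition amalgam_group : groupType := gcolim amalgam_ident.

Definition amalgam_inl (x : A) : amalgam_group :=
  gcolim_in (G := amalgam_factor) amalgam_ident (i := true) x.
Definition amalgam_inr (x : B) : amalgam_group :=
  gcolim_in (G := amalgam_factor) amalgam_ident (i := false) x.

Lemma amalgam_z : amalgam_inl (cd_z A) = amalgam_inr (cd_z B).
Proof.
exact: (@gcolim_in_ident _ _ amalgam_ident (amalgam_letterl _)
  (amalgam_letterr _)).
Qed.

(* The generator h_1 of B: the smallest one for the ordering with cone cd_cone B. *)
Definition least_gen (h : B) : Prop :=
  cd_gens B h /\ forall h', cd_gens B h' -> h = h' \/ cd_cone B (h^-1 * h').

(* The x_i = g_i z_B^-1 h_1 and the h_j. *)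
Definition ito_gens : set amalgam_group :=
  [set x | exists g h1, [/\ cd_gens A g, least_gen h1 &
     x = amalgam_inl g * (amalgam_inr (cd_z B))^-1 * amalgam_inr h1]]
  `|` amalgam_inr @` cd_gens B.

Definition ito_amalgam : coneData :=
  ConeData (amalgam_inl (cd_z A)) ito_gens (semigroup_gen ito_gens).

End Amalgam.

Section InductiveLimit.
Variable D : int -> coneData.

(* stage m is G_(m) with its cone P_(m); the inner amalgam is G'_(k), P'_(k).
   The distinguished element is the common image of all the z_n, |n| <= m. *)
Fixpoint stage (m : nat) : coneData :=
  if m is k.+1 then
    ito_amalgam (D (- (k.+1)%:Z)%R) (ito_amalgam (stage k) (D (k.+1)%:Z))
  else D 0%Z.

Definition stage_emb (m : nat) (x : stage m) : stage m.+1 :=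
  amalgam_inr (D (- (m.+1)%:Z)%R) (B := ito_amalgam (stage m) (D (m.+1)%:Z))
    (amalgam_inl (D (m.+1)%:Z) x).

Definition stage_group (m : nat) : groupType := stage m.

Definition stage_ident (a b : letter stage_group) : Prop :=
  exists (m : nat) (x : stage m),
    a = mkletter (G := stage_group) (i := m) x /\
    b = mkletter (G := stage_group) (i := m.+1) (stage_emb x).

Definition limit_group : groupType := gcolim stage_ident.

Definition limit_in (m : nat) (x : stage m) : limit_group :=
  gcolim_in (G := stage_group) stage_ident (i := m) x.

Definition limit_cone : set limit_group :=
  \bigcup_m (@limit_in m @` cd_cone (stage m)).

End InductiveLimit.
Arguments limit_cone : clear implicits.

(* Main.v *)
Require Import Defs.
From mathcomp Require Import all_boot all_order all_algebra.
From mathcomp Require Import all_classical all_reals topology.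
From mathcomp Require Import finmap zify.
Import Order.TTheory GRing.Theory Num.Theory.

(** Let A and B be groups with positive cones generated by elements smaller
    than central elements z_A and z_B, and let X be their amalgam, in which
    Z = z_A = z_B. Every coset of the powers of z_A or z_B has exactly one
    representative in the interval from 1 (included) to z (excluded), so every
    element of X is Z^k u_1 ... u_n for a unique integer k and a unique word in
    non-trivial such representatives, alternately from A and from B. As in van
    der Waerden's proof, X acts on these normal forms, which is how
    their uniqueness enters.

    The height of a normal form is k plus the number of places where a letter
    of A is followed by a letter of B. It is the integer part of the element
    with respect to Z in Ito's ordering: the generators g Z^-1 h_1 and h_j
    never decrease it ([height_act], [height_act_twisted]), whereas the inverse
    of a positive element sends the empty word to negative height, so 1 is not
    positive ([one_not_positive]). Conversely a non-trivial element of height at least 0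
    is a product of generators, because Z^-1 is spread over the crossings, each
    a Z^-1 b being positive ([word_nonneg]); and an element of negative
    height has a positive inverse ([word_neg]). This proves Ito's theorem, in a
    form that can be iterated: [ito_bounded_cone]. The cones of the stages are
    compatible, so their union is a positive cone of the limit
    ([limit_cone_is_cone]).

    A neighbourhood of the limit ordering is given by finitely many positive
    elements, all in some stage m. Let h be the least positive generator of
    G_(m+1). In the amalgam of stage m with G_(m+1), for every positive a of
    stage m the element h^-1 a h = (h^-1 Z) (a Z^-1 h) is positive
    ([conj_least_cone]), so the conjugate by h stays in the neighbourhood. It
    differs from the ordering: if c is the least positive generator of stage m,
    then c Z^-1 h is positive but h^-1 (c Z^-1 h) h is negative
    ([least_twist_conj]), because h^2 <= Z and c^2 <= Z. *)

Set Implicit Arguments.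
Unset Strict Implicit.
Unset Printing Implicit Defensive.

Local Open Scope classical_set_scope.
Local Open Scope group_scope.

(** * Positive cones *)

Section Cones.
Variable G : groupType.
Implicit Types (P : set G) (x y : G).

Definition is_cone P : Prop :=
  [/\ ~ P 1, mul_closed P & forall x, [\/ P x, x = 1 | P x^-1]].

Definition nonneg P x : Prop := x = 1 \/ P x.

Definition central (z : G) : Prop := forall x, commute z x.

Lemma pos_cone_is_cone (o : leftOrder G) : is_cone (pos_cone o).
Proof.
split; first exact: lo_irr.
- move=> x y ox oy; apply: lo_trans ox _.
  by have := lo_left x oy; rewrite mulg1.
- move=> x; have [ox|<-|ox] := lo_total o 1 x; [exact: Or31|exact: Or32|].
  by apply: Or33; have := lo_left x^-1 ox; rewrite mulVg mulg1.
Qed.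

Lemma cone_order P : is_cone P -> exists o : leftOrder G, pos_cone o = P.
Proof.
move=> [P1 PM Ptot]; pose lt x y := P (x^-1 * y).
have irr x : ~ lt x x by rewrite /lt mulVg.
have trans x y w : lt x y -> lt y w -> lt x w.
  by move=> xy yw; have := PM _ _ xy yw; rewrite mulgA mulgK.
have total x y : [\/ lt x y, x = y | lt y x].
  rewrite /lt; have [|xy|] := Ptot (x^-1 * y); first exact: Or31.
  - by apply: Or32; rewrite -[RHS](mulVKg x) xy mulg1.
  - by rewrite invgM invgK; exact: Or33.
have left g x y : lt x y -> lt (g * x) (g * y).
  by rewrite /lt invgM mulgA mulgVK.
exists (LeftOrder irr trans total left).
by apply/seteqP; split=> x; rewrite /pos_cone /= /lt invg1 mul1g.
Qed.

Lemma lt_cone (o : leftOrder G) x y : o x y <-> pos_cone o (x^-1 * y).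
Proof.
split=> [xy|]; first by have := lo_left x^-1 xy; rewrite mulVg.
by move/(lo_left x); rewrite mulg1 mulVKg.
Qed.

Lemma semigroup_gen_closed (S : set G) : mul_closed (semigroup_gen S).
Proof.
move=> x y Sx Sy T [Tm ST]; apply: (Tm); [exact: Sx|exact: Sy].
Qed.

Section MulClosed.
Variable P : set G.
Hypothesis mulP : mul_closed P.

Lemma coneMn x y : P x -> nonneg P y -> P (x * y).
Proof. by move=> Px [->|]; [rewrite mulg1|exact: mulP]. Qed.

Lemma conenM x y : nonneg P x -> P y -> P (x * y).
Proof. by move=> [->|] Py; [rewrite mul1g|exact: mulP]. Qed.

Lemma nonnegM x y : nonneg P x -> nonneg P y -> nonneg P (x * y).
Proof. by move=> [->|Px] Py; [rewrite mul1g|right; exact: coneMn]. Qed.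

Lemma nonnegX x n : P x -> nonneg P (x ^+ n).
Proof.
move=> Px; elim: n => [|n IHn]; first by left.
by rewrite expgS; right; exact: coneMn.
Qed.

End MulClosed.

Variable P : set G.
Hypothesis coneP : is_cone P.

Lemma cone_mul : mul_closed P.
Proof. by case: coneP. Qed.

Lemma cone_neq1 x : P x -> x <> 1.
Proof. by case: coneP => P1 _ _ + x1; rewrite x1. Qed.

Lemma coneV x : P x -> ~ P x^-1.
Proof. by move=> Px /(cone_mul Px); rewrite mulgV; case: coneP. Qed.

Lemma nonneg_total x : nonneg P x \/ P x^-1.
Proof.
by case: coneP => _ _ /(_ x) [Px|->|Px]; [left; right|left; left|right].
Qed.

Lemma nonneg_anti x : nonneg P x -> ~ P x^-1.
Proof.
case=> [->|Px]; last exact: coneV.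
by rewrite invg1; case: coneP.
Qed.

End Cones.

Lemma centralV (G : groupType) (z : G) : central z -> central z^-1.
Proof. by move=> zC x; apply/commute_sym/commuteV/commute_sym/zC. Qed.

(** * Integer powers and integer parts *)

Lemma twist_div (G : groupType) (z c g h : G) : central z ->
  (c * z^-1 * h)^-1 * (g * z^-1 * h) = h^-1 * (c^-1 * g) * h.
Proof.
move=> zC; rewrite -!(centralV zC) !invgM invgK -!mulgA mulVKg.
by rewrite !mulgA.
Qed.

Section IntegerPowers.
Variables (G : groupType) (z : G).

Definition zpow (k : int) : G :=
  match k with Posz n => z ^+ n | Negz n => z ^- n.+1 end.

Lemma zpow0 : zpow 0 = 1. Proof. by []. Qed.

Lemma zpowS k : zpow (k + 1)%R = z * zpow k.
Proof.
case: k => [n|[|n]].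
- have -> : (Posz n + 1)%R = Posz n.+1 by lia.
  by rewrite /= expgS.
- by rewrite /= expg1 mulgV.
- have -> : (Negz n.+1 + 1)%R = Negz n by lia.
  by rewrite /= [z ^+ n.+2]expgSr invgM mulVKg.
Qed.

Lemma zpowDn k (n : nat) : zpow (n%:Z + k)%R = z ^+ n * zpow k.
Proof.
elim: n => [|n IHn]; first by rewrite add0r mul1g.
by rewrite expgS -mulgA -IHn -zpowS; congr (zpow _); lia.
Qed.

Lemma zpowD j k : zpow (j + k)%R = zpow j * zpow k.
Proof.
case: j => n; first exact: zpowDn.
apply: (mulgI (z ^+ n.+1)); rewrite -zpowDn /= mulVKg; congr (zpow _); lia.
Qed.

Lemma zpowN k : zpow (- k)%R = (zpow k)^-1.
Proof. by apply: (mulIg (zpow k)); rewrite -zpowD mulVg addNr. Qed.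

Lemma zpow_central k : central z -> central (zpow k).
Proof.
move=> zC x; apply: commute_sym; case: k => n /=; rewrite ?/commute.
  exact: commuteX (commute_sym (zC x)).
by apply: commuteV; apply: commuteX; exact: commute_sym (zC x).
Qed.

End IntegerPowers.

Section Morphism.
Variables (G H : groupType) (f : {multiplicative G -> H}).

Lemma mult1 : f 1 = 1.
Proof. by apply: (mulgI (f 1)); rewrite -gmulfM !mulg1. Qed.

Lemma multV x : f x^-1 = (f x)^-1.
Proof. by apply: (mulIg (f x)); rewrite -gmulfM !mulVg mult1. Qed.

Lemma zpow_morph z k : f (zpow z k) = zpow (f z) k.
Proof.
have fX n : f (z ^+ n) = f z ^+ n.
  by elim: n => [|n IHn]; rewrite ?mult1// !expgS gmulfM IHn.
by case: k => n; rewrite /= -fX // multV.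
Qed.

End Morphism.

Section Floor.
Variables (G : groupType) (z : G) (P : set G).

(** The interval from 1 (included) to z (excluded) of the ordering with cone P:
    a fundamental domain for multiplication by the powers of z. *)
Definition fund (r : G) : Prop := nonneg P r /\ P (r^-1 * z).

Definition floor (x : G) : int := xget 0%R [set k | fund (zpow z (- k)%R * x)].

Definition frac (x : G) : G := zpow z (- floor x)%R * x.

Definition central_bound : Prop :=
  [/\ is_cone P, central z, P z & forall x, exists n, P (x^-1 * z ^+ n)].

Hypothesis zP : central_bound.
Let cP : is_cone P. Proof. by case: zP. Qed.
Let mP : mul_closed P. Proof. exact: cone_mul. Qed.
Let zC : central z. Proof. by case: zP. Qed.
Let Pz : P z. Proof. by case: zP. Qed.

Lemma zpow_ge0 k : (0 <= k)%R -> nonneg P (zpow z k).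
Proof. by case: k => n // _; exact: nonnegX. Qed.

Lemma fund1 : fund 1. Proof. by split; [left|rewrite invg1 mul1g]. Qed.

Lemma fund_inv r : P r -> fund r -> fund (r^-1 * z).
Proof.
move=> Pr [_ Prz]; split; first by right.
by rewrite invgM invgK -(zC (z^-1 * r)) mulVKg.
Qed.

(** For positive x the exponent is the least n with x < z^n, minus one. The
    inverse of z^k r is z^(-k) if r = 1, and otherwise z^(-k-1) times r^-1 z,
    again in the fundamental interval. *)
Lemma fund_translate x : exists k, fund (zpow z (- k)%R * x).
Proof.
have pos y : P y -> exists k, fund (zpow z (- k)%R * y).
  move=> Py; have : exists n, `[< P (y^-1 * z ^+ n) >].
    by case: zP => _ _ _ /(_ y) [n]; exists n; apply/asboolP.
  move=> /ex_minnP [n /asboolP Pn minn].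
  case: n Pn minn => [|n] Pn minn; first by rewrite mulg1 in Pn; case: (coneV cP Py).
  exists (Posz n); rewrite zpowN; split.
    have [//|] := nonneg_total cP ((zpow z n)^-1 * y).
    rewrite invgM invgK => /asboolP /minn; lia.
  by rewrite invgM invgK -mulgA /= -expgSr.
case: cP => _ _ /(_ x) [|->|/pos [k [[k0|k0] k1]]]; first exact: pos.
- by exists 0%R; rewrite mul1g; exact: fund1.
- exists (- k)%R; rewrite opprK.
  rewrite (_ : zpow z k * x = 1); first exact: fund1.
  apply: invg_inj; rewrite invgM -zpowN.
  by rewrite -(zpow_central (- k)%R zC) k0 invg1.
- exists (- k - 1)%R; rewrite (_ : _ * x = (zpow z (- k)%R * x^-1)^-1 * z).
    by apply: fund_inv => //; split=> //; right.
  rewrite invgM invgK -zpowN opprK -mulgA -(zC (zpow z k)) -zpowS.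
  by rewrite -(zpow_central (k + 1)%R zC); congr (zpow _ _ * _); lia.
Qed.

Lemma frac_fund x : fund (frac x).
Proof. exact: (xgetPex 0%R (fund_translate x)). Qed.

Lemma floor_frac x : zpow z (floor x) * frac x = x.
Proof. by rewrite /frac mulgA -zpowD subrr mul1g. Qed.

Lemma fund_le k j r s : fund r -> fund s -> zpow z k * r = zpow z j * s ->
  (j <= k)%R.
Proof.
move=> [_ rz] [s0 _] E; case: (lerP j k) => // kj.
have Er : r = zpow z (j - k)%R * s.
  by apply: (mulgI (zpow z k)); rewrite mulgA -zpowD addrC subrK.
have : nonneg P (z^-1 * r).
  rewrite Er mulgA.
  have -> : (j - k)%R = ((j - k - 1) + 1)%R by lia.
  by rewrite zpowS mulKg; apply: nonnegM => //; apply: zpow_ge0; lia.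
by move/(nonneg_anti cP); rewrite invgM invgK.
Qed.

Lemma floor_uniq k r : fund r -> floor (zpow z k * r) = k.
Proof.
move=> fr; have E := floor_frac (zpow z k * r).
have fx := frac_fund (zpow z k * r).
by have := fund_le fx fr E; have := fund_le fr fx (esym E); lia.
Qed.

Lemma frac_uniq k r : fund r -> frac (zpow z k * r) = r.
Proof.
by move=> fr; rewrite /frac floor_uniq// mulgA -zpowD addNr mul1g.
Qed.

Lemma floor_shift k x : floor (zpow z k * x) = (k + floor x)%R.
Proof.
rewrite -[X in _ * X]floor_frac mulgA -zpowD floor_uniq//.
exact: frac_fund.
Qed.

Lemma frac_shift k x : frac (zpow z k * x) = frac x.
Proof.
rewrite -[X in _ * X]floor_frac mulgA -zpowD frac_uniq//.
exact: frac_fund.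
Qed.

Lemma floor_ge0 x : nonneg P x -> (0 <= floor x)%R.
Proof.
move=> x0; case: (lerP 0 (floor x))%R => // x_lt0.
have [_] := frac_fund x.
rewrite /frac invgM -zpowN opprK -mulgA -zC -zpowS => Pxz; exfalso.
apply: (nonneg_anti cP (x := zpow z (- (floor x + 1))%R * x)).
  by apply: nonnegM => //; apply: zpow_ge0; lia.
by rewrite invgM -zpowN opprK.
Qed.

Lemma floor_gt0 x : P x -> frac x = 1 -> (0 < floor x)%R.
Proof.
move=> Px x1; have := floor_ge0 (or_intror Px); rewrite le_eqVlt.
case/orP => // /eqP x0; move: (floor_frac x); rewrite -x0 x1 mul1g.
by move/esym/(cone_neq1 cP Px).
Qed.

Lemma floor_lt0 x : P x -> (floor x^-1 < 0)%R.
Proof.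
move=> Px; case: (ltrP (floor x^-1) 0)%R => // x0.
case: (@nonneg_anti _ _ cP x^-1); last by rewrite invgK.
rewrite -(floor_frac x^-1); apply: nonnegM; first exact: mP.
  exact: zpow_ge0.
by case: (frac_fund x^-1).
Qed.

(** A left ordering need not be invariant on the right, so x > 1 does not give
    x y >= y; it does after rounding y down to a power of z, as z is
    central. *)
Lemma floor_mul x y : nonneg P x -> (floor y <= floor (x * y))%R.
Proof.
move=> x0; rewrite -[in leRHS](floor_frac y) mulgA (commute_sym (zpow_central _ zC x)).
rewrite -mulgA floor_shift lerDl; apply: floor_ge0.
by apply: nonnegM => //; case: (frac_fund y).
Qed.

(** If y = z^k r, then x y = z^k (x r) with x r > 1, so when x r is a power of z its
    exponent is at least 1. This gain makes up for the crossing that disappears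
    when a letter is cancelled. *)
Lemma floor_mul_frac x y : P x -> frac (x * y) = 1 ->
  (floor y < floor (x * y))%R.
Proof.
move=> Px; rewrite -(floor_frac y) mulgA (commute_sym (zpow_central _ zC x)) -mulgA.
rewrite !floor_shift frac_shift => xy1.
rewrite ltrD2l addNr.
by apply: floor_gt0 => //; apply: (coneMn mP Px); case: (frac_fund y).
Qed.

End Floor.

(** * Cones generated by elements below a central element *)

(** The hypotheses of Ito's amalgamation, in the form inherited by the amalgam.
    A least generator, the h_1 of the construction, takes the place of
    a finite list of generators. *)
Record bounded_cone (C : coneData) : Prop := BoundedCone {
  bc_cone : is_cone (cd_cone C);
  bc_central : central (cd_z C);
  bc_gen : cd_cone C = semigroup_gen (cd_gens C);
  bc_lt : forall g, cd_gens C g -> cd_cone C (g^-1 * cd_z C);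
  bc_least : exists h : C, least_gen h }.

Section BoundedCone.
Variable C : coneData.
Hypothesis bC : bounded_cone C.
Let cP := bc_cone bC.
Let mP := cone_mul cP.

Lemma gens_cone g : cd_gens C g -> cd_cone C g.
Proof. by rewrite (bc_gen bC) => gC S [_]; apply. Qed.

Lemma z_cone : cd_cone C (cd_z C).
Proof.
have [h [hg _]] := bc_least bC.
by rewrite -(mulVKg h (cd_z C)); apply: mP (bc_lt bC hg); exact: gens_cone.
Qed.

Lemma cone_ind (S : set C) : mul_closed S -> cd_gens C `<=` S ->
  cd_cone C `<=` S.
Proof. by move=> Sm SG; rewrite (bc_gen bC); exact: smallest_sub. Qed.

Lemma cone_bounded x : exists n, cd_cone C (x^-1 * cd_z C ^+ n).
Proof.
have z1 := z_cone.
have zC n : central (cd_z C ^+ n).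
  by move=> y; apply/commute_sym/commuteX/commute_sym/(bc_central bC).
have [[->|]|] := nonneg_total cP x; first by exists 1%N; rewrite invg1 mul1g.
  move: x; apply: cone_ind => [x y [m xm] [n yn]|g /(bc_lt bC) gz]; last by exists 1%N.
  exists (m + n)%N; rewrite invgM expgnDr -!mulgA.
  rewrite (mulgA x^-1) -(zC n (x^-1 * _)) mulgA.
  exact: mP.
by exists 0%N; rewrite mulg1.
Qed.

Lemma bounded_central : central_bound (cd_z C) (cd_cone C).
Proof.
split; [exact: cP|exact: bc_central|exact: z_cone|exact: cone_bounded].
Qed.

(** A product of generators is at least its first factor, so the least generator
    is the least positive element. *)
Lemma least_gen_le h x : least_gen h -> cd_cone C x ->
  nonneg (cd_cone C) (h^-1 * x).
Proof.
move=> [hg hle].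
suff: cd_cone C `<=` [set x | cd_cone C x /\ nonneg (cd_cone C) (h^-1 * x)].
  by move=> sub /sub[].
apply: cone_ind => [u v [Pu hu] [Pv _]|g gg] /=.
  by split; [exact: mP|right; rewrite mulgA; exact: conenM].
split; first exact: gens_cone.
by have [->|hg'] := hle _ gg; [left; rewrite mulVg|right].
Qed.

Lemma least_gen_uniq (h h' : C) : least_gen h -> least_gen h' -> h = h'.
Proof.
move=> [hg hle] [hg' hle']; have [//|hh'] := hle _ hg'.
have [//|h'h] := hle' _ hg.
by case: (coneV cP hh'); rewrite invgM invgK.
Qed.

End BoundedCone.

(** * Normal forms in an amalgam *)

Arguments zpow : simpl never.

Section NormalForms.
Variables A B : coneData.
Hypotheses (bA : bounded_cone A) (bB : bounded_cone B).

Local Notation F := (amalgam_factor A B).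
Local Notation L := (letter F).
Local Notation X := (amalgam_group A B).
Local Notation state := (int * seq L)%type.

Definition fz (b : bool) : F b :=
  match b return F b with true => cd_z A | false => cd_z B end.

Definition fcone (b : bool) : set (F b) :=
  match b return set (F b) with true => cd_cone A | false => cd_cone B end.

Lemma fbound b : central_bound (fz b) (@fcone b).
Proof. by case: b; exact: bounded_central. Qed.

Definition ffloor b (x : F b) : int := floor (fz b) (@fcone b) x.
Definition ffrac b (x : F b) : F b := frac (fz b) (@fcone b) x.

Definition hd b (l : seq L) : F b :=
  if l is a :: _ then tagged_as (mkletter (1 : F b)) a else 1.

Definition headed b (l : seq L) : bool :=
  if l is a :: _ then tag a == b else false.

Definition tl b (l : seq L) : seq L := if headed b l then behead l else l.

Definition add_letter b (r : F b) (l : seq L) : seq L :=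
  if r == 1 then l else mkletter r :: l.

(** Reduced words have non-trivial letters in the fundamental intervals, and no
    two adjacent letters come from the same factor. A state (k, l) stands for
    the normal form Z^k l. *)
Fixpoint reduced (l : seq L) : Prop :=
  if l is a :: l' then
    [/\ tagged a <> 1, fund (fz (tag a)) (@fcone _) (tagged a),
        ~~ headed (tag a) l' & reduced l']
  else True.

(** For each factor, the states correspond to the pairs of an element x of that
    factor and a word t not starting in it: [join] sends (x, t) to the
    normal form of x t and [split_head] is its inverse. The action of the factor
    is left multiplication on the first component. *)
Definition join b (x : F b) (t : seq L) : state :=
  (ffloor x, add_letter (ffrac x) t).

Definition split_head b (w : state) : F b * seq L :=
  (zpow (fz b) w.1 * hd b w.2, tl b w.2).

Definition act b (x : F b) (w : state) : state :=
  join (x * (split_head b w).1) (split_head b w).2.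

Lemma hd_headless b l : ~~ headed b l -> hd b l = 1.
Proof.
case: l => //= -[c x] l /= /eqP cb; rewrite /tagged_as /=.
by case: eqP => // bc; case: cb.
Qed.

Lemma tl_headless b l : ~~ headed b l -> tl b l = l.
Proof. by rewrite /tl => /negPf ->. Qed.

Lemma hd_cons b (r : F b) l : hd b (mkletter r :: l) = r.
Proof. exact: (@tagged_asE bool (fun i => F i : Type) (mkletter 1) r). Qed.

Lemma tl_cons b (r : F b) l : tl b (mkletter r :: l) = l.
Proof. by rewrite /tl /= eqxx. Qed.

Lemma headed_tl b l : reduced l -> ~~ headed b (tl b l).
Proof.
rewrite /tl; case: ifP => [|/negbT//].
by case: l => //= a l /eqP <- [].
Qed.

Lemma reduced_tl b l : reduced l -> reduced (tl b l).
Proof. by rewrite /tl; case: ifP => //; case: l => //= a l _ []. Qed.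

Lemma hd_add b (r : F b) l : ~~ headed b l -> hd b (add_letter r l) = r.
Proof.
move=> hl; rewrite /add_letter; case: eqP => [->|_]; last exact: hd_cons.
exact: hd_headless.
Qed.

Lemma tl_add b (r : F b) l : ~~ headed b l -> tl b (add_letter r l) = l.
Proof.
move=> hl; rewrite /add_letter; case: eqP => _; last exact: tl_cons.
exact: tl_headless.
Qed.

Lemma add_hd_tl b l : reduced l -> add_letter (hd b l) (tl b l) = l.
Proof.
move=> rl; have [hl|hl] := boolP (headed b l); last first.
  by rewrite hd_headless// tl_headless// /add_letter eqxx.
case: l hl rl => //= -[c r] l /= /eqP cb; case: b / cb => -[/eqP/negPf r1 _ _ _].
rewrite -[existT _ _ _]/(mkletter r) -[tagged_as _ _]/(hd c (mkletter r :: l)).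
by rewrite tl_cons hd_cons /add_letter r1.
Qed.

Lemma fund_hd b l : reduced l -> fund (fz b) (@fcone b) (hd b l).
Proof.
move=> rl; have [hl|hl] := boolP (headed b l); last first.
  rewrite hd_headless//; exact: fund1 (fbound b).
case: l hl rl => //= -[c r] l /= /eqP cb; case: b / cb => -[_ + _ _].
by rewrite -[tagged_as _ _]/(hd c (mkletter r :: l)) hd_cons.
Qed.

Lemma split_join b (x : F b) t : ~~ headed b t -> split_head b (join x t) = (x, t).
Proof.
move=> ht; rewrite /split_head /join /= hd_add// tl_add//.
by rewrite /ffloor /ffrac floor_frac.
Qed.

Lemma join_split b w : reduced w.2 ->
  join (split_head b w).1 (split_head b w).2 = w.
Proof.
case: w => k l /= rl; rewrite /join /split_head /ffloor /ffrac /=.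
have fh := fund_hd b rl.
by rewrite (floor_uniq (fbound b) k fh) (frac_uniq (fbound b) k fh) add_hd_tl.
Qed.

Lemma reduced_join b (x : F b) t : ~~ headed b t -> reduced t ->
  reduced (join x t).2.
Proof.
move=> ht rt; rewrite /join /add_letter /=; case: eqP => //= x1; split=> //.
exact: (frac_fund (fbound b)).
Qed.

Lemma reduced_act b (x : F b) w : reduced w.2 -> reduced (act x w).2.
Proof. by move=> rw; apply: reduced_join; [exact: headed_tl|exact: reduced_tl]. Qed.

Lemma act1 b w : reduced w.2 -> act (1 : F b) w = w.
Proof. by move=> rw; rewrite /act mul1g join_split. Qed.

Lemma actM b (x y : F b) w : reduced w.2 -> act (x * y) w = act x (act y w).
Proof.
move=> rw; rewrite /act split_join; last exact: headed_tl.
by rewrite /= -!mulgA.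
Qed.

(** Both factors let their central element act by raising the exponent, which is
    what makes the two actions agree on the amalgamated subgroup. *)
Lemma act_z b w : reduced w.2 -> act (fz b) w = ((w.1 + 1)%R, w.2).
Proof.
move=> rw; rewrite -[RHS](@join_split b)// /act /split_head /=.
by rewrite zpowS mulgA.
Qed.

Definition word_act (u : seq L) (w : state) : state :=
  foldr (fun a => act (tagged a)) w u.

Lemma word_act_cat u v w : word_act (u ++ v) w = word_act u (word_act v w).
Proof. exact: foldr_cat. Qed.

Lemma reduced_word_act u w : reduced w.2 -> reduced (word_act u w).2.
Proof. by move=> rw; elim: u => //= a u IHu; exact: reduced_act. Qed.

Lemma word_act_eq u v : word_eq (@amalgam_ident A B) u v ->
  forall w, reduced w.2 -> word_act u w = word_act v w.
Proof.
elim=> {u v} [//|u v _ IH w rw|u v t _ IH _ IH' w rw|u u' v v' _ IH _ IH' w rw|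
  b x y w rw|b w rw|a b [-> ->] w rw].
- by rewrite IH.
- by rewrite IH// IH'.
- by rewrite !word_act_cat IH'// IH//; exact: reduced_word_act.
- by rewrite /= -actM.
- by rewrite /= act1.
- by rewrite /= (@act_z true)// (@act_z false).
Qed.

Definition gact (x : X) (w : state) : state := word_act (word_repr x) w.

Lemma gact_class u w : reduced w.2 -> gact (word_class _ u) w = word_act u w.
Proof.
by move=> rw; apply: word_act_eq => //; apply/word_classP; rewrite word_reprK.
Qed.

Lemma gactM x y w : reduced w.2 -> gact (x * y) w = gact x (gact y w).
Proof.
move=> rw; rewrite [gact x _]/gact [gact y _]/gact -word_act_cat.
exact: (gact_class (word_repr x ++ word_repr y)).
Qed.

Lemma reduced_gact x w : reduced w.2 -> reduced (gact x w).2.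
Proof. exact: reduced_word_act. Qed.

Lemma gact_in b (x : F b) w : reduced w.2 ->
  gact (gcolim_in (@amalgam_ident A B) x) w = act x w.
Proof. exact: gact_class. Qed.

(** * The height of a normal form *)

Fixpoint crossings (l : seq L) : nat :=
  if l is a :: l' then ((tag a && headed false l') + crossings l')%N else 0%N.

Definition height (w : state) : int := (w.1 + Posz (crossings w.2))%R.

(** Read through [split_head false], the height is the integer part of the B-component
    plus a constant; through [split_head true] there is in addition a crossing
    exactly when the A-component is not a power of z and a word follows. *)
Lemma height_join_false (y : F false) t :
  height (join y t) = (ffloor y + crossings t)%R.
Proof. by rewrite /height /join /add_letter /=; case: eqP. Qed.

Lemma height_join_true (y : F true) t :
  height (join y t) =
  (ffloor y + (nat_of_bool ((ffrac y != 1%g) && headed false t) + crossings t)%N)%R.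
Proof. by rewrite /height /join /add_letter /=; case: eqP. Qed.

Lemma headed_exclusive l : headed false l -> ~~ headed true l.
Proof. by case: l => //= a l /eqP ->. Qed.

(** The integer part does not decrease; a crossing is lost only when x y becomes a
    power of z, and then the integer part increases. *)
Lemma height_act b (x : F b) w : fcone x -> reduced w.2 ->
  (height w <= height (act x w))%R.
Proof.
move=> Px rw; rewrite -{1}(join_split b rw) /act.
set y := (split_head b w).1; set t := (split_head b w).2.
have := floor_mul (fbound b) y (or_intror Px).
have := floor_mul_frac (fbound b) (x := x) (y := y) Px.
rewrite -/(ffloor y) -/(ffloor (x * y)) -/(ffrac (x * y)).
case: b x w Px rw @y @t => x w Px rw y t; last by rewrite !height_join_false; lia.
rewrite !height_join_true.
by case: (eqVneq (ffrac (x * y)) 1) => /= [xy1 /(_ xy1)|_ _];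
  case: (headed _ t); case: (_ == _) => /=; lia.
Qed.

(** In front of a letter of B, a positive element of A that is a power of z raises
    the exponent, and any other one creates a crossing. *)
Lemma height_act_cross (x : F true) w : fcone x -> reduced w.2 ->
  headed false w.2 -> (height w < height (act x w))%R.
Proof.
move=> Px rw fw; have tw := headed_exclusive fw.
have := @floor_gt0 _ _ _ (fbound true) x Px.
have := @floor_ge0 _ _ _ (fbound true) x (or_intror Px).
rewrite -/(ffloor x) -/(ffrac x).
rewrite /act /split_head hd_headless// tl_headless//= mulg1.
rewrite -(zpow_central _ (bc_central bA)) height_join_true.
rewrite /ffloor /ffrac (floor_shift (fbound true)) (frac_shift (fbound true)) fw.
by rewrite /height; case: eqP => [-> _ /(_ erefl)|_]; lia.
Qed.

Lemma act_zV b w : reduced w.2 -> act (fz b)^-1 w = ((w.1 - 1)%R, w.2).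
Proof.
case: w => k l rl; have -> : (k, l) = act (fz b) ((k - 1)%R, l).
  by rewrite act_z //= subrK.
by rewrite -actM // mulVg act1 // act_z //= addrK.
Qed.

(** The factor z^-1 costs one. If h w starts with a letter of B, the crossing
    created by x pays for it; otherwise h cancelled the first letter of w, and the
    integer part has increased. *)
Lemma height_act_twisted (x : F true) (h : F false) w : fcone x -> fcone h ->
  fcone (h^-1 * fz false) -> reduced w.2 ->
  (height w <= height (act x (act (fz true)^-1 (act h w))))%R.
Proof.
move=> Px Ph hz rw; rewrite act_zV; last exact: reduced_act.
set v := act h w; have rv : reduced v.2 by exact: reduced_act.
have wv : (height w <= height v)%R by exact: height_act.
have [fv|fv] := boolP (headed false v.2).
  have := @height_act_cross x ((v.1 - 1)%R, v.2) Px rv fv.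
  by move: wv; rewrite /height /=; lia.
have := @height_act _ x ((v.1 - 1)%R, v.2) Px rv.
suff : (height w < height v)%R by rewrite /height /=; lia.
move: fv; rewrite /v -{2}(join_split false rw) /act.
set y := (split_head false w).1; set t := (split_head false w).2.
rewrite !height_join_false {1}/join /= /add_letter.
case: eqP => [hy1 _|_]; last by [].
by rewrite ltrD2r; apply: (floor_mul_frac (fbound false)).
Qed.

(** * Positive elements of an amalgam *)

Local Notation inl := (@amalgam_inl A B).
Local Notation inr := (@amalgam_inr A B).
Local Notation P := (semigroup_gen (@ito_gens A B)).

(** The two inclusions as one family of morphisms indexed by the factor. *)
Definition factor_in b : {multiplicative F b -> X} :=
  @gcolim_in _ _ (@amalgam_ident A B) b.

Lemma amalgam_inlM : {morph inl : x y / x * y}.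
Proof. by move=> x y; exact: (@gmulfM _ _ (factor_in true) x y). Qed.

Lemma amalgam_inrM : {morph inr : x y / x * y}.
Proof. by move=> x y; exact: (@gmulfM _ _ (factor_in false) x y). Qed.

Lemma amalgam_inlV : {morph inl : x / x^-1}.
Proof. by move=> x; exact: (multV (factor_in true) x). Qed.

Lemma amalgam_inrV : {morph inr : x / x^-1}.
Proof. by move=> x; exact: (multV (factor_in false) x). Qed.

Lemma amalgam_inl1 : inl 1 = 1. Proof. exact: (mult1 (factor_in true)). Qed.
Lemma amalgam_inr1 : inr 1 = 1. Proof. exact: (mult1 (factor_in false)). Qed.

Local Notation Z := (inr (cd_z B)).

Lemma amalgam_zE : inl (cd_z A) = Z. Proof. exact: amalgam_z. Qed.

Lemma word_class_cons (a : L) l :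
  word_class (@amalgam_ident A B) (a :: l) =
  factor_in (tag a) (tagged a) * word_class _ l.
Proof. by case: a => b x; rewrite -[RHS]/(gcolim_mul _ _) word_class_cat. Qed.

Lemma factor_z b : factor_in b (fz b) = Z.
Proof. by case: b => //; exact: amalgam_z. Qed.

Lemma amalgam_z_central : central (Z : X).
Proof.
move=> x; rewrite -[x]word_reprK; elim: (word_repr x) => [|a l IHl].
  exact: commute1.
rewrite word_class_cons; apply: commuteM => //.
rewrite -(factor_z (tag a)); apply/commute_sym; rewrite /commute -!gmulfM.
by congr (factor_in _ _); case: (fbound (tag a)) => _ zC _ _; rewrite zC.
Qed.

Section Generators.
Variable h : B.
Hypothesis lh : least_gen h.

Let mP : mul_closed P. Proof. exact: semigroup_gen_closed. Qed.
Let hz : cd_cone B (h^-1 * cd_z B). Proof. by case: lh => /(bc_lt bB). Qed.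

Lemma ito_gens_sub : @ito_gens A B `<=` P.
Proof. by move=> x gx S [_]; apply. Qed.

Lemma inr_cone b : cd_cone B b -> P (inr b).
Proof.
move: b; apply: (cone_ind bB) => [x y Px Py|g gg] /=.
  by rewrite amalgam_inrM; exact: mP.
by apply: ito_gens_sub; right; exists g.
Qed.

Lemma twist_gen g : cd_gens A g -> P (inl g * Z^-1 * inr h).
Proof. by move=> gg; apply: ito_gens_sub; left; exists g, h. Qed.

(** For a generator, g = (g Z^-1 h) (h^-1 Z). Both claims pass to products, since
    a a' Z^-1 h = a (a' Z^-1 h). *)
Lemma inl_twist_cone a : cd_cone A a -> P (inl a) /\ P (inl a * Z^-1 * inr h).
Proof.
move: a; apply: (cone_ind bA) => [x y [Px _] [Py Pyh]|g gg].
  rewrite amalgam_inlM; split; first exact: mP.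
  by rewrite -!mulgA; apply: mP => //; rewrite mulgA.
split; last exact: twist_gen.
have -> : inl g = inl g * Z^-1 * inr h * inr (h^-1 * cd_z B).
  by rewrite amalgam_inrM amalgam_inrV mulgA mulgK mulgVK.
by apply: mP; [exact: twist_gen|exact: inr_cone].
Qed.

Lemma inl_cone a : cd_cone A a -> P (inl a).
Proof. by case/inl_twist_cone. Qed.

Lemma cross_cone a b : cd_cone A a -> cd_cone B b -> P (inl a * Z^-1 * inr b).
Proof.
move=> Pa Pb; have -> : inr b = inr h * inr (h^-1 * b) by rewrite -amalgam_inrM mulVKg.
rewrite mulgA; apply: coneMn => //; first by case: (inl_twist_cone Pa).
have [->|] := least_gen_le bB lh Pb; first by left; exact: amalgam_inr1.
by right; exact: inr_cone.
Qed.

(** As Z is central, h^-1 a h = (h^-1 Z) (a Z^-1 h). *)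
Lemma conj_least_cone a : cd_cone A a -> P ((inr h)^-1 * inl a * inr h).
Proof.
move=> Pa; have -> : (inr h)^-1 * inl a * inr h =
    inr (h^-1 * cd_z B) * (inl a * Z^-1 * inr h).
  rewrite amalgam_inrM amalgam_inrV -!mulgA; congr (_ * _).
  by rewrite amalgam_z_central -!mulgA -(amalgam_z_central (inr h)) mulKg.
by apply: mP; [exact: inr_cone|case: (inl_twist_cone Pa)].
Qed.

(** * Ito's theorem *)

Definition value (w : state) : X := zpow Z w.1 * word_class _ w.2.

Lemma value_join b (x : F b) t :
  value (join x t) = factor_in b x * word_class _ t.
Proof.
rewrite -[in RHS](floor_frac (fz b) (@fcone b) x) gmulfM zpow_morph factor_z -mulgA.
rewrite /value /join /add_letter /=; congr (_ * _).
rewrite -/(ffrac x).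
case: (ffrac x =P 1) => [fx1|_]; last by rewrite word_class_cons.
by rewrite fx1 mult1 mul1g.
Qed.

Lemma value_act b (x : F b) w : reduced w.2 ->
  value (act x w) = factor_in b x * value w.
Proof.
move=> rw; rewrite -[in RHS](join_split b rw) /act !value_join.
by rewrite gmulfM mulgA.
Qed.

Lemma value_gact x w : reduced w.2 -> value (gact x w) = x * value w.
Proof.
move=> rw; rewrite -[x in RHS]word_reprK /gact.
elim: (word_repr x) => [|a l IHl] /=; first by rewrite mul1g.
rewrite value_act; last exact: reduced_word_act.
by rewrite IHl word_class_cons mulgA.
Qed.

Definition start : state := (0%R, [::]).

Lemma value_start x : value (gact x start) = x.
Proof. by rewrite value_gact// /value /= !mulg1. Qed.

Lemma zpow_Z_nonneg k : (0 <= k)%R -> nonneg P (zpow Z k).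
Proof.
move=> k0; rewrite -[Z]/(factor_in false (cd_z B)) -zpow_morph.
have [->|] := zpow_ge0 (bounded_central bB) k0; first by left; exact: mult1.
by right; exact: inr_cone.
Qed.

(** The identity decreases no height either; the second clause excludes it. That
    clause passes to products because y maps y^-1 x^-1 to x^-1 and decreases no
    height. *)
Definition height_grows : set X :=
  [set x | (forall w, reduced w.2 -> (height w <= height (gact x w))%R) /\
           (height (gact x^-1 start) < 0)%R].

Lemma height_grows_mul : mul_closed height_grows.
Proof.
move=> x y [xle xlt] [yle ylt]; split=> [w rw|].
  rewrite gactM//; apply: le_trans (yle _ rw) _.
  by apply: xle; exact: reduced_gact.
apply: le_lt_trans xlt; rewrite invgM gactM//.
rewrite -[in leRHS](mulKg y^-1 x^-1) invgK gactM// gactM//.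
by apply: yle; do 2![apply: reduced_gact => //].
Qed.

Lemma gact_inl (a : A) w : reduced w.2 -> gact (inl a) w = act (a : F true) w.
Proof. exact: (@gact_in true). Qed.

Lemma gact_inr (b : B) w : reduced w.2 -> gact (inr b) w = act (b : F false) w.
Proof. exact: (@gact_in false). Qed.

(** Here t is empty or a single letter of A, so it contributes no crossing, and
    b^-1 lowers the integer part. *)
Lemma height_actV_start (b : B) k (r : F true) t : cd_cone B b ->
  t = add_letter r [::] ->
  (height (act (b^-1 : F false) (k, t)) < k)%R.
Proof.
move=> Pb ->; rewrite /act height_join_false /split_head hd_headless ?tl_headless /=;
  try by rewrite /add_letter; case: (r =P 1).
rewrite mulg1 -(zpow_central k (bc_central bB)) /ffloor floor_shift; last first.
  exact: (fbound false).
have := floor_lt0 (fbound false) Pb.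
have -> : crossings (add_letter r [::]) = 0%N by rewrite /add_letter; case: (r =P 1).
by rewrite addr0 gtrDl.
Qed.

Lemma positive_height : P `<=` height_grows.
Proof.
apply: smallest_sub; first exact: height_grows_mul.
move=> _ [[g [h' [gg [hg' _] ->]]]|[b gb <-]]; last first.
  have Pb := gens_cone bB gb; split=> [w rw|].
    by rewrite gact_inr//; exact: height_act.
  rewrite -amalgam_inrV gact_inr//.
  by apply: (@height_actV_start _ _ 1) => //; rewrite /add_letter eqxx.
have [Pg Ph'] := (gens_cone bA gg, gens_cone bB hg').
split=> [w rw|].
  rewrite gactM// gactM; last exact: reduced_gact.
  rewrite gact_inr// -amalgam_zE -amalgam_inlV gact_inl; last first.
    exact/reduced_gact/reduced_act.
  rewrite gact_inl; last exact: reduced_act.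
  by apply: height_act_twisted => //; exact: (bc_lt bB hg').
rewrite !invgM invgK -amalgam_inrV -amalgam_inlV -amalgam_zE -amalgam_inlM gactM//.
have fg : fund (cd_z A) (cd_cone A) (cd_z A * g^-1).
  rewrite (bc_central bA); apply: (fund_inv (bounded_central bA)) => //.
  by split; [right|exact: (bc_lt bA gg)].
rewrite [gact (inl _) _]gact_inl// gact_inr; last exact: reduced_act.
rewrite /act {2}/join.
have -> : ffloor ((cd_z A * g^-1 : F true) * (split_head true start).1) = 0%R.
  rewrite /split_head /= !mulg1.
  rewrite -[_ * _](mul1g) -(zpow0 (cd_z A)).
  exact: (floor_uniq (bounded_central bA) 0%R fg).
exact: (@height_actV_start _ 0%R).
Qed.

Lemma one_not_positive : ~ P 1.
Proof.
by move/positive_height => [_]; rewrite invg1 -amalgam_inr1 gact_inr// act1.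
Qed.

Lemma zpow_Z_mulCA k x y : zpow Z k * (x * y) = x * (zpow Z k * y).
Proof. by rewrite !mulgA (zpow_central k amalgam_z_central x). Qed.

Lemma letter_positive b (r : F b) : r <> 1 -> fund (fz b) (@fcone b) r -> fcone r.
Proof. by move=> r1 [[]]. Qed.

Lemma letter_complement b (r : F b) : fund (fz b) (@fcone b) r ->
  fcone (fz b * r^-1).
Proof. by case: (fbound b) => _ zC _ _ [_]; rewrite zC. Qed.

(** Each crossing a b receives one factor Z^-1 and becomes the positive element
    a Z^-1 b. The second clause carries the induction across a crossing. *)
Lemma word_nonneg l : reduced l ->
  nonneg P (zpow Z (- Posz (crossings l))%R * word_class _ l) /\
  (headed false l -> forall a, cd_cone A a ->
    P (inl a * Z^-1 * (zpow Z (- Posz (crossings l))%R * word_class _ l))).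
Proof.
elim: l => [|[b r] l IHl]; first by split=> //; left; rewrite mulg1.
move=> [r1 fr hl /IHl [l0 lcross]].
have Pr := letter_positive r1 fr.
rewrite word_class_cons /=; case: b r r1 fr hl Pr => r r1 fr hl Pr /=; last first.
  rewrite zpow_Z_mulCA; split=> [|_ a Pa].
    by right; apply: coneMn => //; exact: inr_cone.
  by rewrite mulgA; apply: coneMn => //; exact: cross_cone.
split=> //; right; case: (headed false l) lcross => [/(_ isT _ Pr) lr|_].
  rewrite add1n (_ : (- _)%R = (-1 - Posz (crossings l))%R); last by lia.
  rewrite zpowD -(mulgA (zpow Z (-1)%R)).
  by rewrite (zpow_Z_mulCA (- Posz (crossings l))%R) zpow_Z_mulCA mulgA.
rewrite zpow_Z_mulCA.
by apply: coneMn => //; exact: inl_cone.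
Qed.

(** Multiplying the inverse word by Z^(crossings + 1) turns it into a product of
    the positive complements z u^-1 of its letters u, with one Z^-1 between the
    complement of a letter of A and that of the letter of B before it. *)
Definition coval l : X :=
  (word_class _ l)^-1 * zpow Z (Posz (crossings l) + 1)%R.

Lemma coval_false (r : B) l :
  coval (mkletter (r : F false) :: l) = coval l * Z^-1 * inr (cd_z B * r^-1).
Proof.
rewrite /coval word_class_cons /= add0n invgM amalgam_inrM amalgam_inrV.
rewrite !mulgA mulgVK -!mulgA.
by rewrite -(zpow_central _ amalgam_z_central).
Qed.

Lemma coval_true (r : A) l :
  coval (mkletter (r : F true) :: l) =
  (if headed false l then coval l else coval l * Z^-1) *
  inl (cd_z A * r^-1).
Proof.
rewrite /coval word_class_cons /= invgM amalgam_inlM amalgam_inlV amalgam_zE.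
have E (y : X) : y * (inl r)^-1 * Z = y * (Z * (inl r)^-1).
  by rewrite -mulgA amalgam_z_central.
case: (headed false l); rewrite ?add0n ?add1n.
  rewrite (_ : (Posz _.+1 + 1)%R = ((Posz (crossings l) + 1) + 1)%R); last by lia.
  rewrite [in LHS]zpowS mulgA E -!mulgA; congr (_ * _).
  by rewrite [RHS]zpow_Z_mulCA (zpow_central _ amalgam_z_central).
rewrite !mulgA mulgVK -!mulgA; congr (_ * _).
by rewrite -(zpow_central _ amalgam_z_central).
Qed.

Lemma coval_nil : coval [::] = Z.
Proof. by rewrite /coval invg1 mul1g. Qed.

(** The second clause says that the last factor is a positive element a of A; when
    a letter r of B is put in front of the word, the product acquires the last
    factor Z^-1 (z r^-1), and a Z^-1 (z r^-1) is positive. *)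
Lemma word_neg l : reduced l ->
  P (coval l) /\
  (headed true l -> exists2 m, nonneg P m &
     exists2 a, cd_cone A a & coval l = m * inl a).
Proof.
elim: l => [|[b r] l IHl].
  by split=> //; rewrite coval_nil; apply: inr_cone; exact: z_cone.
move=> [/= r1 fr hl /IHl [l0 lhead]].
have Pr := letter_complement fr.
case: b r r1 fr hl Pr => r r1 fr hl Pr.
  suff [m m0 E] : exists2 m, nonneg P m &
      coval (mkletter (r : F true) :: l) = m * inl (cd_z A * r^-1).
    split=> [|_]; rewrite E; last by exists m => //; exists (cd_z A * r^-1).
    exact: (conenM mP m0 (inl_cone Pr)).
  rewrite coval_true; case: ifP => fl.
    by exists (coval l) => //; right.
  exists 1; first by left.
  case: l hl fl {IHl l0 lhead} => [_ _|[[] ? ?]//].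
  by rewrite coval_nil mulgV.
split=> //; rewrite coval_false.
case: l hl lhead {IHl l0} => [_ _|[[] x l]// _ /(_ isT) [m m0 [a Pa ->]]].
  by rewrite coval_nil mulgV mul1g; exact: (inr_cone Pr).
by rewrite -!mulgA; apply: (conenM mP m0); rewrite !mulgA; exact: (cross_cone Pa Pr).
Qed.

Lemma positive_total x : [\/ P x, x = 1 | P x^-1].
Proof.
have rs : reduced (gact x start).2 by exact: reduced_gact.
have := value_start x; case: (gact x start) rs => k l /= rl <-; rewrite /value /=.
have [l0 _] := word_nonneg rl; have [l1 _] := word_neg rl.
have [k0|k0] := lerP 0%R (k + Posz (crossings l))%R.
  have : nonneg P (zpow Z k * word_class _ l).
    rewrite (_ : k = ((k + Posz (crossings l)) - Posz (crossings l))%R); last by lia.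
    by rewrite zpowD -mulgA; apply: nonnegM => //; exact: zpow_Z_nonneg.
  by case=> ?; [exact: Or32|exact: Or31].
(* x^-1 = coval l * Z^j with j >= 0. *)
apply: Or33; rewrite invgM -zpowN.
rewrite (_ : (- k)%R = ((Posz (crossings l) + 1) + (- k - Posz (crossings l) - 1))%R).
  by rewrite zpowD mulgA; apply: coneMn => //; apply: zpow_Z_nonneg; lia.
by lia.
Qed.

Lemma ito_cone : is_cone P.
Proof.
by split; [exact: one_not_positive|exact: mP|exact: positive_total].
Qed.

End Generators.

(** The inverse is (h^-2 Z) (c^-2 Z) (c Z^-1 h). Both h^-1 Z and c^-1 Z are positive,
    hence at least h and c, which are least positive elements. *)
Lemma least_twist_conj (h : B) (c : A) : least_gen h -> least_gen c ->
  P ((inr h)^-1 * (inl c * Z^-1 * inr h) * inr h)^-1.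
Proof.
move=> lh lc; have mP : mul_closed P by exact: semigroup_gen_closed.
have [hz cz] := ((bc_lt bB) _ lh.1, (bc_lt bA) _ lc.1).
have -> : ((inr h)^-1 * (inl c * Z^-1 * inr h) * inr h)^-1 =
    inr (h^-1 * (h^-1 * cd_z B)) *
    (inl (c^-1 * (c^-1 * cd_z A)) * (inl c * Z^-1 * inr h)).
  rewrite !amalgam_inrM !amalgam_inlM amalgam_zE !amalgam_inrV !amalgam_inlV.
  rewrite -(centralV amalgam_z_central) !invgM !invgK.
  rewrite -!mulgA mulVKg mulKg; do 2!congr (_ * _).
  by rewrite !mulgA amalgam_z_central.
apply: (conenM mP).
  have [->|] := least_gen_le bB lh hz; first by left; exact: amalgam_inr1.
  by right; exact: inr_cone.
apply: (conenM mP); last exact: (twist_gen lh lc.1).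
have [->|] := least_gen_le bA lc cz; first by left; exact: amalgam_inl1.
by right; exact: (inl_cone lh).
Qed.

(** The least generator of the amalgam is c Z^-1 h: for a generator g > c of A,
    its quotient with g Z^-1 h is a conjugate of c^-1 g by h, and its quotient
    with b in B is a conjugate of z c^-1 by h times h^-1 b. *)
Lemma ito_bounded_cone : bounded_cone (ito_amalgam A B).
Proof.
have [h lh] := bc_least bB; have [c lc] := bc_least bA.
have mP : mul_closed P by exact: semigroup_gen_closed.
have hz : P (inr (h^-1 * cd_z B)) by apply: inr_cone; case: lh => /(bc_lt bB).
have gz g : cd_gens A g -> P (inl g^-1 * Z).
  by move/(bc_lt bA) => /(inl_cone lh); rewrite amalgam_inlM amalgam_zE.
split.
- exact: (ito_cone lh).
- by rewrite /= amalgam_zE; exact: amalgam_z_central.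
- by [].
- move=> _ [[g [h' [gg lh' ->]]]|[b gb <-]] /=; rewrite amalgam_zE.
    rewrite -(least_gen_uniq bB lh lh') !invgM invgK -!mulgA -amalgam_inlV.
    rewrite mulgA -amalgam_inrV -amalgam_inrM.
    by apply: mP => //; exact: gz.
  by rewrite -amalgam_inrV -amalgam_inrM; apply: inr_cone; exact: (bc_lt bB).
- exists (inl c * Z^-1 * inr h); split.
    by left; exists c, h; split=> //; case: lc.
  move=> _ [[g [h' [gg lh' ->]]]|[b gb <-]] /=.
    rewrite -(least_gen_uniq bB lh lh').
    have [-> |cg] := lc.2 _ gg; first by left.
    right; rewrite (twist_div _ _ _ amalgam_z_central) -amalgam_inlV -amalgam_inlM.
    exact: (conj_least_cone lh cg).
  (* (c Z^-1 h)^-1 b = (h^-1 (z c^-1) h) (h^-1 b) *)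
  right; rewrite (_ : _ * _ = (inr h)^-1 * inl (cd_z A * c^-1) * inr h * inr (h^-1 * b)).
    have Pb := gens_cone bB gb.
    apply: coneMn => //.
      apply: (conj_least_cone lh); rewrite (bc_central bA).
      by apply: (bc_lt bA); case: lc.
    have [->|] := least_gen_le bB lh Pb; first by left; exact: amalgam_inr1.
    by right; exact: inr_cone.
  rewrite !invgM invgK amalgam_inlM amalgam_inlV amalgam_zE amalgam_inrM amalgam_inrV.
  by rewrite -!mulgA mulVKg.
Qed.

End NormalForms.

(** * Neighbourhoods and least generators *)

Lemma nbhs_leftOrder (G : groupType) (o : leftOrder G) (U : set (leftOrder G)) :
  nbhs o U -> exists s : seq G, (forall x, x \in s -> pos_cone o x) /\
    forall o' : leftOrder G, (forall x, x \in s -> pos_cone o' x) -> U o'.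
Proof.
rewrite nbhsE => -[V [[I ID IV] Vo] VU].
move: Vo; rewrite -IV => -[W IW Wo].
have [K KD KW] := ID _ IW.
have {KW}WE : W = \bigcap_(S in [set` (K : {fset set (leftOrder G)})]) S by rewrite -KW.
have {}Wo : (W : set (leftOrder G)) o := Wo.
(* g S is an element whose positivity defines the member S of the subbase. *)
pose g (S : set (leftOrder G)) : G := xget 1 [set g | S = [set o | o 1 g]].
have gK S : S \in K -> S = [set o : leftOrder G | o 1 (g S)].
  move=> /KD /set_mem [x _ /esym E].
  exact: (@xgetPex _ 1 [set y | S = [set o : leftOrder G | o 1 y]] (ex_intro _ x E)).
exists (map g K); split=> [_ /mapP[S SK ->]|o' o'g].
  by move: Wo; rewrite WE => /(_ _ SK); rewrite {1}(gK _ SK).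
apply: VU; rewrite -IV; exists W => //.
suff : (W : set (leftOrder G)) o' by [].
rewrite WE => S SK.
by rewrite (gK _ SK); apply: o'g; exact: map_f.
Qed.

Lemma seq_least_gen (C : coneData) (s : seq C) : is_cone (cd_cone C) ->
  cd_gens C = [set` s] -> s <> [::] -> exists h : C, least_gen h.
Proof.
rewrite /least_gen => cP ->; elim: s => // x s IHs _.
have [->|/IHs [y [ys yle]]] := pselect (s = [::]).
  exists x; split=> [|h']; rewrite /= ?mem_head// inE => /eqP ->; by left.
have xs : x \in x :: s by exact: mem_head.
have sub t : t \in s -> t \in x :: s by rewrite inE => ->; rewrite orbT.
case: cP => _ PM /(_ (x^-1 * y)) [xy|xy|yx].
- exists x; split=> // t; rewrite /= inE => /orP[/eqP ->|/yle [<-|yt]].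
  + by left.
  + by right.
  + by right; have := PM _ _ xy yt; rewrite mulgA mulgK.
- exists y; split=> [|t]; first exact: sub.
  rewrite /= inE => /orP[/eqP ->|/yle//].
  by left; rewrite -[y](mulVKg x) xy mulg1.
- exists y; split=> [|t]; first exact: sub.
  rewrite /= inE => /orP[/eqP ->|/yle//].
  by right; move: yx; rewrite invgM invgK.
Qed.

(** * The cone of the limit *)

Section Limit.
Variable D : int -> coneData.
Hypothesis bD : forall n, bounded_cone (D n).

Local Notation stage_letter := (letter (stage_group D)).

Lemma stage_bounded m : bounded_cone (stage D m).
Proof.
elim: m => [|m IHm]; first exact: bD.
exact: (ito_bounded_cone (bD _) (ito_bounded_cone IHm (bD _))).
Qed.

Lemma half_stage_bounded m :
  bounded_cone (ito_amalgam (stage D m) (D m.+1)).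
Proof. exact: (ito_bounded_cone (stage_bounded m) (bD _)). Qed.

Lemma stage_embM m : {morph @stage_emb D m : x y / x * y}.
Proof. by move=> x y; rewrite /stage_emb amalgam_inlM amalgam_inrM. Qed.

Lemma stage_emb_cone m (x : stage D m) :
  cd_cone (stage D m) x -> cd_cone (stage D m.+1) (stage_emb x).
Proof.
have [h lh] := bc_least (bD m.+1).
move=> Px; apply: (inr_cone (half_stage_bounded m)).
exact: (inl_cone (stage_bounded m) (bD _) lh Px).
Qed.

(** The image in stage n of a letter of stage i, meaningful for i <= n; below the
    level of the letter the value is a default. *)
Fixpoint raise (n : nat) (a : stage_letter) : stage D n :=
  match n return stage D n with
  | 0 => tagged_as (@mkletter _ (stage_group D) 0%N 1) a
  | k.+1 => if tag a == k.+1 then tagged_as (@mkletter _ (stage_group D) k.+1 1) a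
            else stage_emb (raise k a)
  end.

Lemma raise_same m (x : stage D m) : raise m (mkletter (G := stage_group D) x) = x.
Proof.
case: m x => [|m] x /=; rewrite ?eqxx;
  exact: (@tagged_asE nat (fun i => stage_group D i : Type)
            (mkletter (G := stage_group D) 1) x).
Qed.

Lemma raiseS m n (x : stage D m) : (m <= n)%N ->
  raise n.+1 (mkletter (G := stage_group D) x) =
  stage_emb (raise n (mkletter (G := stage_group D) x)).
Proof. by move=> mn /=; case: eqP => // E; lia. Qed.

Lemma geq_ind (m : nat) (S : nat -> Prop) : S m ->
  (forall n, (m <= n)%N -> S n -> S n.+1) -> forall n, (m <= n)%N -> S n.
Proof.
move=> S0 SS; elim=> [|n IHn]; first by rewrite leqn0 => /eqP <-.
by rewrite leq_eqVlt => /orP[/eqP <-//|mn]; apply: SS => //; exact: IHn.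
Qed.

Local Notation mk x := (@mkletter _ (stage_group D) _ x).

Lemma raiseM m n (x y : stage D m) : (m <= n)%N ->
  raise n (mk (x * y)) = raise n (mk x) * raise n (mk y).
Proof.
move: n; apply: geq_ind => [|n mn IHn]; first by rewrite !raise_same.
by rewrite !raiseS// IHn stage_embM.
Qed.

Lemma raise_emb m n (x : stage D m) : (m.+1 <= n)%N ->
  raise n (mk x) = raise n (mk (stage_emb x)).
Proof.
move: n; apply: geq_ind => [|n mn IHn].
  by rewrite raiseS// !raise_same.
by rewrite !raiseS// 1?ltnW// IHn.
Qed.

Lemma raise_cone m n (x : stage D m) : (m <= n)%N ->
  cd_cone (stage D m) x -> cd_cone (stage D n) (raise n (mk x)).
Proof.
move=> + Px; move: n; apply: geq_ind => [|n mn IHn]; first by rewrite raise_same.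
by rewrite raiseS//; exact: stage_emb_cone.
Qed.

Definition word_raise n (u : seq stage_letter) : stage D n :=
  \prod_(a <- u) raise n a.

(** A derivation of an equality in the limit involves finitely many letters, hence
    holds in every late enough stage. *)
Lemma word_raise_eq u v : word_eq (@stage_ident D) u v ->
  exists N, forall n, (N <= n)%N -> word_raise n u = word_raise n v.
Proof.
rewrite /word_raise.
elim=> {u v} [u|u v _ [N IH]|u v w _ [N IH] _ [N' IH']|u u' v v' _ [N IH] _ [N' IH']|
  i x y|i|a b [m [x [-> ->]]]].
- by exists 0%N.
- by exists N => n /IH.
- by exists (maxn N N') => n; rewrite geq_max => /andP[/IH -> /IH' ->].
- exists (maxn N N') => n; rewrite geq_max => /andP[/IH E /IH' E'].
  by rewrite !big_cat E E'.
- exists i => n ni; rewrite !big_cons !big_nil !mulg1.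
  by symmetry; exact: raiseM.
- exists i => n ni; rewrite big_cons !big_nil mulg1.
  by apply: (mulgI (raise n (mk (1 : stage D i)))); rewrite -raiseM// !mulg1.
- by exists m.+1 => n mn; rewrite !big_cons !big_nil !mulg1; exact: raise_emb.
Qed.

Lemma limit_inM m : {morph @limit_in D m : x y / x * y}.
Proof. move=> x y; exact: gcolim_in_mul. Qed.

Lemma limit_in1 m : limit_in (1 : stage D m) = 1.
Proof. by apply: (mulgI (limit_in (1 : stage D m))); rewrite -limit_inM !mulg1. Qed.

Lemma limit_inV m (x : stage D m) : limit_in x^-1 = (limit_in x)^-1.
Proof. by apply: (mulIg (limit_in x)); rewrite -limit_inM !mulVg limit_in1. Qed.

Lemma limit_in_emb m (x : stage D m) : limit_in (stage_emb x) = limit_in x.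
Proof.
symmetry; apply: (@gcolim_in_ident _ _ (@stage_ident D) (mk x) (mk (stage_emb x))).
by exists m, x.
Qed.

Lemma limit_in_raise m n (x : stage D m) : (m <= n)%N ->
  limit_in (raise n (mk x)) = limit_in x.
Proof.
move: n; apply: geq_ind => [|n mn IHn]; first by rewrite raise_same.
by rewrite raiseS// limit_in_emb.
Qed.

Lemma limit_in_surj (x : limit_group D) : exists m (y : stage D m), x = limit_in y.
Proof.
rewrite -[x]word_reprK; elim: (word_repr x) => [|[i y] u [m [t E]]].
  by exists 0%N, 1; rewrite limit_in1.
exists (maxn i m), (raise (maxn i m) (mk y) * raise (maxn i m) (mk t)).
rewrite limit_inM !limit_in_raise ?leq_maxl ?leq_maxr// -E.
by rewrite [RHS](word_class_cat _ [:: _]).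
Qed.

(** Everything is checked in a common stage; 1 is excluded since an equality with
    1 in the limit already holds in a stage, whose cone omits 1. *)
Lemma limit_cone_is_cone : is_cone (limit_cone D).
Proof.
split.
- move=> [m _ [x Px x1]].
  have /word_classP/word_raise_eq [N EN] : limit_in x = word_class (@stage_ident D) [::].
    exact: x1.
  have := EN _ (leq_maxl N m); rewrite /word_raise big_cons !big_nil mulg1.
  apply: (cone_neq1 (bc_cone (stage_bounded _))).
  exact: (raise_cone (leq_maxr N m)).
- move=> _ _ [m _ [x Px <-]] [n _ [y Py <-]].
  exists (maxn m n) => //; exists (raise (maxn m n) (mk x) * raise (maxn m n) (mk y)).
    by apply: (cone_mul (bc_cone (stage_bounded _))); apply: raise_cone;
      rewrite ?leq_maxl ?leq_maxr.
  by rewrite limit_inM !limit_in_raise ?leq_maxl ?leq_maxr.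
- move=> x; have [m [y ->]] := limit_in_surj x.
  case: (bc_cone (stage_bounded m)) => _ _ /(_ y) [Py|->|Py].
  + by apply: Or31; exists m => //; exists y.
  + by apply: Or32; exact: limit_in1.
  + by apply: Or33; exists m => //; exists y^-1 => //; rewrite limit_inV.
Qed.

Lemma limit_cone_finite (s : seq (limit_group D)) :
  (forall x, x \in s -> limit_cone D x) -> exists m,
  forall x, x \in s -> exists2 y : stage D m, cd_cone (stage D m) y & limit_in y = x.
Proof.
elim: s => [|x s IHs] sP; first by exists 0%N.
have [|m ms] := IHs; first by move=> y ys; apply: sP; rewrite inE ys orbT.
have [n _ [y Py yx]] := sP _ (mem_head x s).
exists (maxn m n) => t; rewrite inE => /orP[/eqP ->|/ms [u Pu <-]].
  exists (raise (maxn m n) (mk y)); first by apply: raise_cone; rewrite ?leq_maxr.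
  by rewrite limit_in_raise// leq_maxr.
exists (raise (maxn m n) (mk u)); first by apply: raise_cone; rewrite ?leq_maxl.
by rewrite limit_in_raise// leq_maxl.
Qed.

End Limit.

(** * Approximation by conjugates *)

Section LimitApproximated.
Variable D : int -> coneData.
Hypothesis bD : forall n, bounded_cone (D n).

(** The intermediate amalgam of stage m with G_(m+1), where the conjugating element
    is found, seen in the limit. *)
Definition half_in m (y : ito_amalgam (stage D m) (D m.+1)) : limit_group D :=
  @limit_in D m.+1 (amalgam_inr (D (- m.+1%:Z)%R) y).

Lemma half_inM m : {morph @half_in m : x y / x * y}.
Proof. by move=> x y; rewrite /half_in amalgam_inrM limit_inM. Qed.

Lemma half_inV m y : @half_in m y^-1 = (half_in y)^-1.
Proof. by rewrite /half_in amalgam_inrV limit_inV. Qed.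

Lemma half_in_inl m (x : stage D m) : half_in (amalgam_inl (D m.+1) x) = limit_in x.
Proof. exact: limit_in_emb. Qed.

Lemma half_in_cone m (y : ito_amalgam (stage D m) (D m.+1)) :
  cd_cone (ito_amalgam (stage D m) (D m.+1)) y -> limit_cone D (half_in y).
Proof.
move=> Py; exists m.+1 => //; exists (amalgam_inr (D (- m.+1%:Z)%R) y) => //.
exact: (inr_cone (half_stage_bounded bD m)).
Qed.

(** If the finitely many positive elements that define a neighbourhood lie in stage
    m, the conjugate by the least generator h of G_(m+1) keeps them positive. *)
Lemma limit_approximated (o : leftOrder (limit_group D)) :
  pos_cone o = limit_cone D -> approximated_by_conjugates o.
Proof.
move=> oE U /nbhs_leftOrder [s [so sU]].
have [m ms] := limit_cone_finite bD (fun x xs => eq_ind _ (fun S => S x) (so x xs) _ oE).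
have [h lh] := bc_least (bD m.+1); have [c lc] := bc_least (stage_bounded bD m).
have [bS bH] := (stage_bounded bD m, bD m.+1).
pose g := half_in (amalgam_inr (stage D m) h).
have conjE x : pos_cone (conj_order o g) x <-> limit_cone D (g^-1 * x * g).
  by rewrite -oE /pos_cone /= mul1g lt_cone mulgA.
exists g; split.
  apply: sU => x /ms [y Py <-]; apply/conjE.
  rewrite -half_in_inl -half_inV -!half_inM; apply: half_in_cone.
  exact: (conj_least_cone bS bH lh Py).
(* The positive element c Z^-1 h becomes negative. *)
move=> oo; pose e := amalgam_inl (D m.+1) c *
  (amalgam_inr (stage D m) (cd_z (D m.+1)))^-1 * amalgam_inr (stage D m) h.
have : pos_cone (conj_order o g) (half_in e).
  rewrite oo oE; apply: half_in_cone; exact: (twist_gen lh lc.1).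
move/conjE=> Pe; apply: (coneV (limit_cone_is_cone bD) Pe).
rewrite -half_inV -!half_inM -half_inV; apply: half_in_cone.
exact: (least_twist_conj bS bH lh lc).
Qed.

End LimitApproximated.

Theorem theorem1p2 (G : int -> groupType) (z : forall n : int, G n)
    (lt : forall n : int, leftOrder (G n)) (gen : forall n : int, seq (G n))
    (D := fun n : int => ConeData (z n) [set` gen n] (pos_cone (lt n))) :
  (forall n, finitely_generated (G n)) ->
  (forall n, z n <> 1) ->
  (forall n (x : G n), commute (z n) x) ->
  (forall n, isolated [set: leftOrder (G n)] (lt n)) ->
  (forall n, pos_cone (lt n) = semigroup_gen [set` gen n]) ->
  (forall n (g : G n), g \in gen n -> lt n g (z n)) ->
  infinite_set [set n | ~ isomorphic_to_subgroup (G n) (subgroup_gen [set z n])] ->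
  (exists o : leftOrder (limit_group D),
     pos_cone o = limit_cone D /\ approximated_by_conjugates o) /\
  ~ (exists o : leftOrder (limit_group D),
       pos_cone o = limit_cone D /\ isolated [set: leftOrder (limit_group D)] o).
Proof.
move=> _ z1 zC _ genE genz _.
have bD n : bounded_cone (D n).
  split=> /=.
  - exact: pos_cone_is_cone.
  - exact: zC.
  - exact: genE.
  - by move=> g /genz /lt_cone.
  - apply: (@seq_least_gen (D n) (gen n)) => //; first exact: pos_cone_is_cone.
    (* Without generators the cone is empty, but it contains z n or its inverse. *)
    move=> gen0; have P0 x : ~ pos_cone (lt n) x.
      rewrite genE gen0 => /(_ set0); apply; split=> // y.
    case: (pos_cone_is_cone (lt n)) => _ _ /(_ (z n)) [/P0|/z1|/P0] //.
split.
  have [o oE] := cone_order (limit_cone_is_cone bD).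
  by exists o; split=> //; exact: (limit_approximated bD).
move=> [o [oE [_ [V Vo]]]]; rewrite setIT => VE.
have [g [Vg]] := limit_approximated bD oE Vo.
by move: Vg; rewrite VE.
Qed.
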